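(* There exist a sequence $(n_k)_k$ of natural numbers and a family of sofic representations $\Theta_i:\mathbb{F}_2\to\Pi_{k\to\omega}P_{n_k}$, $i\in[0,1]$, of the free group $\mathbb{F}_2$ on two generators such that each $\Theta_i$ is an expander and, for all $i\neq j$, $\Theta_i$ and $\Theta_j$ are not conjugated, i.e. there is no $q\in\Pi_{k\to\omega}P_{n_k}$ with $q\Theta_i(g)q^*=\Theta_j(g)$ for all $g\in\mathbb{F}_2$.
   Context: $\omega$ is a fixed free ultrafilter on $\mathbb{N}$. $M_n$ is the algebra of $n\times n$ complex matrices with normalised trace $Tr(x)=\frac1n\sum_ix(i,i)$; $D_n\subset M_n$ is the diagonal subalgebra and $P_n\subset M_n$ the group of permutation matrices. The Hamming distance on matrices is $d_H(x,y)=\frac1n|\{i:\exists j\ x(i,j)\neq y(i,j)\}|$ (on $P_n$ it is the usual normalised Hamming distance). For $\lim_kn_k=\infty$, $\Pi_{k\to\omega}P_{n_k}$ is the group of sequences in $\prod_kP_{n_k}$ modulo those with $\lim_{k\to\omega}d_H(p_k,Id)=0$; $\Pi_{k\to\omega}p_k$ denotes the class of $(p_k)_k$ and $Tr(\Pi_{k\to\omega}p_k)=\lim_{k\to\omega}Tr(p_k)$. A sofic representation of a group $G$ is a homomorphism $\Theta:G\to\Pi_{k\to\omega}P_{n_k}$ with $Tr(\Theta(g))=0$ for all $g\neq1_G$. For $\lambda>0$, a collection $p_1,\ldots,p_s\in P_n$ is a $\lambda$-expander if for every projection $e\in D_n$ with $0<Tr(e)\leq\frac12$ we have $\lambda Tr(e)<\sum_{i=1}^sd_H(e,p_iep_i^*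 )$. A sofic representation $\Theta:G\to\Pi_{k\to\omega}P_{n_k}$ is an expander if for some $\lambda>0$ there exist $g_1,\ldots,g_s\in G$ and $p_k^i\in P_{n_k}$ such that $\Theta(g_i)=\Pi_{k\to\omega}p_k^i$ for $i=1,\ldots,s$ and $\{p_k^1,\ldots,p_k^s\}$ is a $\lambda$-expander for each $k\in\mathbb{N}$. *)

(* Defs.v *)
From HB Require Import structures.
From mathcomp Require Import all_boot all_order all_fingroup all_algebra.
From mathcomp Require Import complex.
From mathcomp Require Import all_classical all_reals all_analysis.

Set Implicit Arguments.
Unset Strict Implicit.
Unset Printing Implicit Defensive.

Import Order.TTheory GRing.Theory Num.Theory.
Import numFieldNormedType.Exports.

Local Open Scope quotient_scope.
Local Open Scope classical_set_scope.
Local Open Scope complex_scope.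
Local Open Scope ring_scope.

(* The free group on the set T: reduced words in the letters (x, false),
   standing for x, and (x, true), standing for x^-1. *)
Section FreeGroup.
Variable T : choiceType.
Implicit Types (a b : T * bool) (s t u : seq (T * bool)).

Definition letter_inv a : T * bool := (a.1, ~~ a.2).

Definition reduced s : bool := sorted (fun a b => b != letter_inv a) s.

Record freeGroup := FreeGroup {
  fword :> seq (T * bool);
  fword_reduced : reduced fword }.

HB.instance Definition _ := [isSub for fword].
HB.instance Definition _ := [Choice of freeGroup by <:].

Definition push a s : seq (T * bool) :=
  if s is b :: t then if b == letter_inv a then t else a :: s else [:: a].

Definition word_mul s t : seq (T * bool) := foldr push t s.

Definition word_inv s : seq (T * bool) := rev (map letter_inv s).

Lemma letter_invK : involutive letter_inv.
Proof. by case=> x b; rewrite /letter_inv /= negbK. Qed.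

Lemma reduced_behead a s : reduced (a :: s) -> reduced s.
Proof. exact: path_sorted. Qed.

Lemma push_reduced a s : reduced s -> reduced (push a s).
Proof.
case: s => [//|b t] rs /=; case: eqP => [_|/eqP nb]; first exact: reduced_behead rs.
by rewrite /= nb.
Qed.

Lemma word_mul_reduced s t : reduced t -> reduced (word_mul s t).
Proof. by move=> rt; elim: s => //= a s IH; exact: push_reduced. Qed.

Lemma push_cons a s : reduced (a :: s) -> push a s = a :: s.
Proof. by case: s => [//|b t] /= /andP[/negPf ->]. Qed.

Lemma word_muls0 s : reduced s -> word_mul s [::] = s.
Proof.
elim: s => //= a s IH rs; rewrite IH ?push_cons //.
exact: reduced_behead rs.
Qed.

Lemma pushK a s : reduced s -> push a (push (letter_inv a) s) = s.
Proof.
case: s => [|b t] rs /=; first by rewrite eqxx.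
rewrite letter_invK; case: eqP => [eba|_]; last by rewrite /= eqxx.
by rewrite -eba push_cons.
Qed.

Lemma word_mul_push a s t : reduced s -> reduced t ->
  word_mul (push a s) t = push a (word_mul s t).
Proof.
case: s => [//|b s] rs rt /=; case: eqP => [->|//].
by rewrite pushK // word_mul_reduced.
Qed.

Lemma word_mulA s t u : reduced s -> reduced t -> reduced u ->
  word_mul s (word_mul t u) = word_mul (word_mul s t) u.
Proof.
elim: s => //= a s IH rs rt ru; have rs' := reduced_behead rs.
by rewrite IH // word_mul_push // word_mul_reduced.
Qed.

Lemma word_inv_reduced s : reduced s -> reduced (word_inv s).
Proof.
rewrite /reduced /word_inv rev_sorted sorted_map.
apply: sub_sorted => a b /=; apply: contraNN => /eqP ->.
by rewrite letter_invK.
Qed.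

Lemma word_mulVs s : reduced s -> word_mul (word_inv s) s = [::].
Proof.
elim: s => //= a s IH rs; rewrite /word_inv /= rev_cons /word_mul foldr_rcons /=.
by rewrite letter_invK eqxx; apply: IH; exact: reduced_behead rs.
Qed.

Lemma word_invK s : word_inv (word_inv s) = s.
Proof. by rewrite /word_inv map_rev revK (mapK letter_invK). Qed.

Definition fg_one : freeGroup := @FreeGroup [::] isT.
Definition fg_mul (x y : freeGroup) : freeGroup :=
  FreeGroup (word_mul_reduced x (fword_reduced y)).
Definition fg_inv (x : freeGroup) : freeGroup :=
  FreeGroup (word_inv_reduced (fword_reduced x)).

Lemma fg_mulA : associative fg_mul.
Proof. by move=> x y z; apply: val_inj; apply: word_mulA; exact: fword_reduced. Qed.
Lemma fg_mul1 : left_id fg_one fg_mul.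
Proof. by move=> x; apply: val_inj. Qed.
Lemma fg_1mul : right_id fg_one fg_mul.
Proof. by move=> x; apply: val_inj; exact/word_muls0/fword_reduced. Qed.
Lemma fg_mulV : left_inverse fg_one fg_inv fg_mul.
Proof. by move=> x; apply: val_inj; exact/word_mulVs/fword_reduced. Qed.
Lemma fg_Vmul : right_inverse fg_one fg_inv fg_mul.
Proof.
move=> x; apply: val_inj; rewrite /= -{1}[fword x]word_invK.
exact/word_mulVs/word_inv_reduced/fword_reduced.
Qed.

HB.instance Definition _ :=
  isGroup.Build freeGroup fg_mulA fg_mul1 fg_1mul fg_mulV fg_Vmul.

Definition fg_gen (x : T) : freeGroup := @FreeGroup [:: (x, false)] isT.

Local Open Scope group_scope.

Lemma freeGroup_universal (G : groupType) (f : T -> G) :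
  (exists h : {multiplicative freeGroup -> G}, forall x, h (fg_gen x) = f x) /\
  (forall h1 h2 : {multiplicative freeGroup -> G},
     (forall x, h1 (fg_gen x) = h2 (fg_gen x)) -> h1 =1 h2).
Proof.
split.
  pose v a := if a.2 then (f a.1)^-1 else f a.1.
  pose ev s := foldr (fun a g => v a * g) 1 s.
  have vV a : v (letter_inv a) = (v a)^-1.
    by case: a => x []; rewrite /v /= ?invgK.
  have evp a s : ev (push a s) = v a * ev s.
    case: s => [//|b s] /=; case: eqP => [->|//].
    by rewrite vV mulgA mulgV mul1g.
  have evM : {morph (fun x : freeGroup => ev x) : x y / x * y}.
    move=> [s rs] [t rt] /=; elim: s {rs} => [|a s IH] /=; first by rewrite mul1g.
    by rewrite evp IH mulgA.
  pose m := isMultiplicative.Build _ _ _ evM.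
  exists (HB.pack_for {multiplicative freeGroup -> G}
            (fun x : freeGroup => ev x) m).
  by move=> x; rewrite /= /v /= mulg1.
move=> h1 h2 h12.
have h1_1 (h : {multiplicative freeGroup -> G}) : h 1 = 1.
  by apply: (mulgI (h 1)); rewrite -gmulfM !mulg1.
have hV (h : {multiplicative freeGroup -> G}) x : h x^-1 = (h x)^-1.
  by apply: (mulgI (h x)); rewrite -gmulfM !mulgV h1_1.
have h12' (a : T * bool) : h1 (@FreeGroup [:: a] isT) = h2 (@FreeGroup [:: a] isT).
  case: a => x [] //; last exact: h12.
  have -> : @FreeGroup [:: (x, true)] isT = (fg_gen x)^-1 by exact: val_inj.
  by rewrite !hV h12.
case=> s; elim: s => [|a s IH] rs.
  have -> : FreeGroup rs = 1 by exact: val_inj.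
  by rewrite !h1_1.
have rs' := reduced_behead rs.
have -> : FreeGroup rs = @FreeGroup [:: a] isT * FreeGroup rs'.
  by apply: val_inj; rewrite /= push_cons.
by rewrite !gmulfM h12' IH.
Qed.

End FreeGroup.

Notation F2 := (freeGroup 'I_2).

Record freeUltrafilter := FreeUltrafilter {
  ufilter :> set_system nat;
  ufilter_ultra : UltraFilter ufilter;
  ufilter_free : \bigcap_(A in ufilter) A = set0 }.

#[global] Existing Instance ufilter_ultra.

Section Matrices.
Variable R : realType.

Definition ntr n (x : 'M[R[i]]_n) : R[i] := n%:R^-1 * \tr x.

Definition dH n (x y : 'M[R[i]]_n) : R :=
  n%:R^-1 * #|[set i : 'I_n | [exists j, x i j != y i j]]%SET|%:R.

Definition diag_projection n (e : 'M[R[i]]_n) : Prop :=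
  [/\ is_diag_mx e, e *m e = e & e ^t* %sesqui = e].

(* The permutation matrices are the perm_mx p for p : 'S_n; since
   perm_mx (p * q) = perm_mx p *m perm_mx q, the group P_n is 'S_n. *)
Definition lambda_expander (lambda : R) n s (p : 'I_s -> 'S_n) : Prop :=
  forall e : 'M[R[i]]_n, diag_projection e -> 0 < ntr e <= 2^-1 ->
    lambda%:C * ntr e <
    (\sum_(i < s) dH e (perm_mx (p i) *m e *m (perm_mx (p i)) ^t* %sesqui))%:C.


Lemma dH_perm n (p q : 'S_n) :
  dH (perm_mx p) (perm_mx q) = n%:R^-1 * #|[set i | p i != q i]%SET|%:R.
Proof.
congr (_ * _%:R); apply: eq_card => i; rewrite !inE.
apply/existsP/idP => [[j]|pq]; first by rewrite !mxE; apply: contraNN => /eqP ->.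
exists (p i); rewrite !mxE eqxx eq_sym.
by rewrite eq_sym (negPf (_ : q i != p i)) ?oner_eq0 // eq_sym.
Qed.

Lemma dH_ge0 n (x y : 'M[R[i]]_n) : 0 <= dH x y.
Proof. by rewrite mulr_ge0 // invr_ge0. Qed.

Lemma dH_permC n (p q : 'S_n) :
  dH (perm_mx p) (perm_mx q) = dH (perm_mx q) (perm_mx p).
Proof. by rewrite !dH_perm; congr (_ * _%:R); apply: eq_card => i; rewrite !inE eq_sym. Qed.

Lemma dH_perm_tri n (p q r : 'S_n) :
  dH (perm_mx p) (perm_mx r) <=
  dH (perm_mx p) (perm_mx q) + dH (perm_mx q) (perm_mx r).
Proof.
rewrite !dH_perm -mulrDr ler_wpM2l ?invr_ge0 // -natrD ler_nat.
rewrite -cardsUI; apply: leq_trans (leq_addr _ _); apply: subset_leq_card.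
apply/fintype.subsetP => i; rewrite !inE -negb_and.
by apply: contraNN => /andP[/eqP -> /eqP ->].
Qed.

Lemma dH_permMl n (r p q : 'S_n) :
  dH (perm_mx (r * p)%g) (perm_mx (r * q)%g) = dH (perm_mx p) (perm_mx q).
Proof.
rewrite !dH_perm; congr (_ * _%:R).
rewrite -[RHS](card_preimset _ (@perm_inj _ r)); apply: eq_card => i.
by rewrite !inE !permM.
Qed.

Lemma dH_permMr n (r p q : 'S_n) :
  dH (perm_mx (p * r)%g) (perm_mx (q * r)%g) = dH (perm_mx p) (perm_mx q).
Proof.
rewrite !dH_perm; congr (_ * _%:R); apply: eq_card => i.
by rewrite !inE !permM (inj_eq perm_inj).
Qed.

Lemma ntr_permB_le n (p q : 'S_n) :
  `|ntr (perm_mx p) - ntr (perm_mx q)| <= (dH (perm_mx p) (perm_mx q))%:C.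
Proof.
rewrite dH_perm -mulrBr normrM rmorphM /= ger0_norm ?invr_ge0 //.
rewrite fmorphV !rmorph_nat ler_wpM2l ?invr_ge0 // /mxtrace -sumrB.
apply: le_trans (ler_norm_sum _ _ _) _.
rewrite -sum1_card natr_sum [leRHS]big_mkcond ler_sum //= => i _.
rewrite !mxE !inE; case: (p i =P q i) => [->|_] /=; first by rewrite subrr normr0.
by case: (p i == i); case: (q i == i);
  rewrite ?subrr ?subr0 ?sub0r ?normrN ?normr0 ?normr1.
Qed.

End Matrices.

Section Ultraproduct.
Variables (R : realType) (omega : freeUltrafilter) (n : nat -> nat).

Definition prodP : Type := forall k, 'S_(n k).

HB.instance Definition _ := gen_eqMixin prodP.
HB.instance Definition _ := gen_choiceMixin prodP.

Implicit Types p q r : prodP.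

Definition prodP_one : prodP := fun k => 1%g.
Definition prodP_mul p q : prodP := fun k => (p k * q k)%g.
Definition prodP_inv p : prodP := fun k => (p k)^-1%g.

Lemma prodP_mulA : associative prodP_mul.
Proof. by move=> p q r; apply: functional_extensionality_dep => k; exact: mulgA. Qed.
Lemma prodP_mul1 : left_id prodP_one prodP_mul.
Proof. by move=> p; apply: functional_extensionality_dep => k; exact: mul1g. Qed.
Lemma prodP_1mul : right_id prodP_one prodP_mul.
Proof. by move=> p; apply: functional_extensionality_dep => k; exact: mulg1. Qed.
Lemma prodP_mulV : left_inverse prodP_one prodP_inv prodP_mul.
Proof. by move=> p; apply: functional_extensionality_dep => k; exact: mulVg. Qed.
Lemma prodP_Vmul : right_inverse prodP_one prodP_inv prodP_mul.
Proof. by move=> p; apply: functional_extensionality_dep => k; exact: mulgV. Qed.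

HB.instance Definition _ := isGroup.Build prodP
  prodP_mulA prodP_mul1 prodP_1mul prodP_mulV prodP_Vmul.

Definition null_seq p : Prop :=
  dH (perm_mx (p k)) (1%:M : 'M[R[i]]_(n k)) @[k --> ufilter omega] --> (0 : R).

Definition uequiv p q : bool := `[< null_seq (p^-1 * q)%g >].

Lemma uequivP p q : reflect
  (dH (perm_mx (p k)) (perm_mx (q k) : 'M[R[i]]_(n k))
     @[k --> ufilter omega] --> (0 : R))
  (uequiv p q).
Proof.
suff e : (fun k => dH (perm_mx ((p^-1 * q)%g k)) (1%:M : 'M[R[i]]_(n k))) =
         (fun k => dH (perm_mx (p k)) (perm_mx (q k) : 'M[R[i]]_(n k))).
  by rewrite /uequiv /null_seq e; exact: asboolP.
apply/funext => k; rewrite -(perm_mx1 _ (n k)) dH_permC.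
by rewrite -(dH_permMl _ (p k)) mulg1 [(_ * _)%g]mulKVg.
Qed.

Lemma uequiv_refl : reflexive uequiv.
Proof.
move=> p; apply/uequivP.
have -> : (fun k => dH (perm_mx (p k)) (perm_mx (p k) : 'M[R[i]]_(n k))) =
          fun=> 0 :> R.
  apply/funext => k; rewrite dH_perm (_ : [set _ | _]%SET = finset.set0) ?cards0 ?mulr0 //.
  by apply/setP => i; rewrite !inE eqxx.
exact: cvg_cst.
Qed.

Lemma uequiv_sym : symmetric uequiv.
Proof.
by move=> p q; apply/uequivP/uequivP; apply: cvg_trans; apply: near_eq_cvg;
  apply: nearW => k; exact: dH_permC.
Qed.

Lemma null_squeeze (f g : nat -> R) : (forall k, 0 <= f k <= g k) ->
  g k @[k --> ufilter omega] --> (0 : R) -> f k @[k --> ufilter omega] --> (0 : R).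
Proof.
move=> fg g0; apply: (@squeeze_cvgr _ _ _ _ (fun=> 0) g) => //; last exact: cvg_cst.
by apply: nearW => k; exact: fg.
Qed.

Lemma uequiv_trans : transitive uequiv.
Proof.
move=> q p r /uequivP pq /uequivP qr; apply/uequivP.
have s := cvgD pq qr; rewrite addr0 in s; apply: (null_squeeze _ (s _)) => k /=.
by rewrite dH_ge0 dH_perm_tri.
Qed.

Canonical uequiv_equiv := EquivRel uequiv uequiv_refl uequiv_sym uequiv_trans.

Definition ultraP : Type := {eq_quot uequiv}.

HB.instance Definition _ := Choice.on ultraP.
HB.instance Definition _ := EqQuotient.on ultraP.

Definition uclass p : ultraP := \pi_ultraP p.

Lemma uclassP p q : uclass p = uclass q <-> null_seq (p^-1 * q)%g.
Proof.
split=> [/eqmodP/asboolP //|pq]; exact/eqmodP/asboolP.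
Qed.

Lemma uequiv_mul p p' q q' :
  uequiv p p' -> uequiv q q' -> uequiv (p * q)%g (p' * q')%g.
Proof.
move=> /uequivP pp /uequivP qq.
apply: (uequiv_trans (y := (p * q')%g)); apply/uequivP.
- apply: cvg_trans qq; apply: near_eq_cvg; apply: nearW => k.
  by rewrite -(dH_permMl _ (p k)).
- apply: cvg_trans pp; apply: near_eq_cvg; apply: nearW => k.
  by rewrite -(dH_permMr _ (q' k)).
Qed.

Lemma uequiv_inv p q : uequiv p q -> uequiv p^-1%g q^-1%g.
Proof.
rewrite uequiv_sym => /uequivP pq; apply/uequivP.
apply: cvg_trans pq; apply: near_eq_cvg; apply: nearW => k.
rewrite -[RHS](dH_permMl _ (q k)) -[RHS](dH_permMr _ (p k)).
by rewrite -mulgA [(p^-1)%g k]/((p k)^-1)%g [(q^-1)%g k]/((q k)^-1)%g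
           mulVg mulgV mulg1 mul1g.
Qed.

Definition urepr (x : ultraP) : prodP := generic_quotient.repr x.

Definition u_one : ultraP := uclass 1%g.
Definition u_mul (x y : ultraP) : ultraP := uclass (urepr x * urepr y)%g.
Definition u_inv (x : ultraP) : ultraP := uclass (urepr x)^-1%g.

Lemma uequiv_repr p : uequiv (urepr (uclass p)) p.
Proof. by rewrite -eqmodE reprK. Qed.

Lemma uclassK (x : ultraP) : uclass (urepr x) = x.
Proof. exact: reprK. Qed.

Lemma u_mulE p q : u_mul (uclass p) (uclass q) = uclass (p * q)%g.
Proof. by apply/eqmodP/uequiv_mul; exact: uequiv_repr. Qed.

Lemma u_invE p : u_inv (uclass p) = uclass p^-1%g.
Proof. by apply/eqmodP/uequiv_inv; exact: uequiv_repr. Qed.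

Lemma u_mulA : associative u_mul.
Proof.
move=> x y z; rewrite -(uclassK x) -(uclassK y) -(uclassK z).
by rewrite !u_mulE mulgA.
Qed.
Lemma u_mul1 : left_id u_one u_mul.
Proof. by move=> x; rewrite -(uclassK x) u_mulE mul1g. Qed.
Lemma u_1mul : right_id u_one u_mul.
Proof. by move=> x; rewrite -(uclassK x) u_mulE mulg1. Qed.
Lemma u_mulV : left_inverse u_one u_inv u_mul.
Proof. by move=> x; rewrite -(uclassK x) u_invE u_mulE mulVg. Qed.
Lemma u_Vmul : right_inverse u_one u_inv u_mul.
Proof. by move=> x; rewrite -(uclassK x) u_invE u_mulE mulgV. Qed.

HB.instance Definition _ := isGroup.Build ultraP
  u_mulA u_mul1 u_1mul u_mulV u_Vmul.

Lemma uclassM p q : uclass (p * q)%g = (uclass p * uclass q)%g.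
Proof. exact/esym/u_mulE. Qed.

Definition utr (x : ultraP) : R[i] :=
  lim ((ntr (perm_mx (urepr x k)) : R[i]^o) @[k --> ufilter omega]).

Lemma ultra_cvg_segment (f : nat -> R) : (forall k, 0 <= f k <= 1) ->
  exists l : R, f k @[k --> ufilter omega] --> l.
Proof.
move=> f01.
have fF : ProperFilter (f @ ufilter omega) by exact: fmap_proper_filter.
have f01o : (f @ ufilter omega) `[0, 1]%classic.
  rewrite /fmap /=; apply: (@filterS _ (ufilter omega) _ setT); last exact: filterT.
  by move=> k _; rewrite /= in_itv /=; exact: f01.
have [l [_ cl]] := @segment_compact R 0 1 (f @ ufilter omega) fF f01o.
exists l => N Nl.
have [//|oN] := in_ultra_setVsetC (f @^-1` N) (ufilter_ultra omega).
by have [x [/= nNx Nx]] := cl (~` N) N oN Nl.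
Qed.

Lemma cvg_real_complex (f : nat -> R) (l : R) :
  f k @[k --> ufilter omega] --> l ->
  ((f k)%:C : R[i]^o) @[k --> ufilter omega] --> (l%:C : R[i]^o).
Proof.
move=> fl; apply/cvgrPdist_lt => -[e e'] e0.
have /andP[/eqP e'0 e_gt0] : (e' == 0) && (0 < e) by move: e0; rewrite ltcE.
move/cvgrPdist_lt : fl => /(_ e e_gt0); apply: filterS => k fk.
by rewrite e'0 -rmorphB /= normc_def /= expr0n addr0 sqrtr_sqr ltcR.
Qed.

Lemma ntr_perm m (p : 'S_m) :
  ntr (perm_mx p) = (m%:R^-1 * #|[set i | p i == i]%SET|%:R)%:C :> R[i].
Proof.
rewrite rmorphM /= fmorphV !rmorph_nat /ntr; congr (_ * _).
rewrite /mxtrace -sum1_card natr_sum [RHS]big_mkcond.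
by apply: eq_bigr => i _; rewrite !mxE !inE; case: eqP.
Qed.

(* The limit defining utr exists and does not depend on the representative. *)
Lemma cvg_utr p :
  (ntr (perm_mx (p k)) : R[i]^o) @[k --> ufilter omega]
    --> (utr (uclass p) : R[i]^o).
Proof.
set q := urepr (uclass p).
have qcv : cvg ((ntr (perm_mx (q k)) : R[i]^o) @[k --> ufilter omega]).
  have [k|l ql] := @ultra_cvg_segment
      (fun k => (n k)%:R^-1 * #|[set i | q k i == i]%SET|%:R).
    rewrite mulr_ge0 ?invr_ge0 //=.
    have [n0|n0] := posnP (n k).
      by rewrite (_ : (n k)%:R^-1 = 0) ?mul0r ?ler01 // n0 invr0.
    rewrite ler_pdivrMl ?ltr0n // mulr1 ler_nat.
    by rewrite -[leqRHS]card_ord max_card.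
  apply/cvg_ex; exists (l%:C : R[i]^o).
  move/cvg_real_complex : ql; apply: cvg_trans; apply: near_eq_cvg.
  by apply: nearW => k; rewrite ntr_perm.
have /uequivP/cvg_real_complex qp := uequiv_repr p.
have d0 : (ntr (perm_mx (p k)) - ntr (perm_mx (q k)) : R[i]^o)
    @[k --> ufilter omega] --> (0 : R[i]^o).
  apply/cvgrPdist_lt => e e0.
  move/cvgrPdist_lt : qp => /(_ e e0); apply: filterS => k.
  rewrite !sub0r !normrN; apply: le_lt_trans.
  rewrite distrC [leRHS]ger0_norm ?ler0c ?dH_ge0 //.
  exact: ntr_permB_le.
have := cvgD d0 qcv; rewrite add0r => H.
apply: cvg_trans (H _); apply: near_eq_cvg; apply: nearW => k /=.
exact: subrK.
Qed.

End Ultraproduct.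

Definition sofic_representation (R : realType) (omega : freeUltrafilter)
    (n : nat -> nat) (G : groupType)
    (Theta : {multiplicative G -> ultraP R omega n}) : Prop :=
  forall g : G, g <> 1%g -> utr (Theta g) = 0.

Definition expander_representation (R : realType) (omega : freeUltrafilter)
    (n : nat -> nat) (G : groupType)
    (Theta : {multiplicative G -> ultraP R omega n}) : Prop :=
  exists lambda : R, 0 < lambda /\
  exists (s : nat) (g : 'I_s -> G) (p : 'I_s -> prodP n),
    (forall i, Theta (g i) = uclass R omega (p i)) /\
    (forall k, lambda_expander lambda (fun i => p i k)).

Definition conjugated (R : realType) (omega : freeUltrafilter) (n : nat -> nat)
    (G : groupType) (Theta Psi : {multiplicative G -> ultraP R omega n}) : Prop :=
  exists q : ultraP R omega n, forall g : G, (q * Theta g * q^-1)%g = Psi g.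

(* Main.v *)
Require Import Defs.
From HB Require Import structures.
From mathcomp Require Import all_boot all_order all_fingroup all_algebra.
From mathcomp Require Import complex.
From mathcomp Require Import all_classical all_reals all_analysis.
From mathcomp Require Import zify ring lra.

(** The proof is probabilistic.  Let u = (u 0, u 1) be a uniformly random pair of
    permutations of n points.
    - A nonempty reduced word w fixes a given point under u with probability at
      most |w|^2 / (n - |w|): at the first step where its trajectory meets
      itself, the image can be rerouted to any of the n - |w| fresh points.
    - u is a 1/88-expander with probability at least 3/4: the image of an m-set A
      under a random permutation is uniform among m-sets, only few m-sets nearly
      coincide with A, and the square of their proportion beats the union bound
      over A.
    - A conjugate of a fixed pair, modified at up to n/4 points in each
      coordinate, is one of at most n! (n^_(n/4))^2 pairs, which is o((n!)^2).
    Hence for a suitable n_k >= k a greedy choice gives k + 1 expanding pairs which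
    nearly satisfy no short relation and are pairwise far from conjugate.  The
    representation of index i in [0,1] uses the pair of number floor(i k) at level
    k; for i < j these numbers differ as soon as k > 1 / (j - i). *)

Set Implicit Arguments.
Unset Strict Implicit.
Unset Printing Implicit Defensive.

Import Order.TTheory GRing.Theory Num.Theory.
Import numFieldNormedType.Exports.
Local Open Scope nat_scope.

(** * Fixed points of reduced words *)

Lemma leq_card_bigcup (I T : finType) (P : pred I) (F : I -> {set T}) :
  #|\bigcup_(i | P i) F i| <= \sum_(i | P i) #|F i|.
Proof.
elim/big_ind2: _ => [|m A k B Am Bk|//]; first by rewrite cards0.
by apply: leq_trans (leq_card_setU A B) _; exact: leq_add.
Qed.

Section Trajectory.
Context (n : nat).
Implicit Types (u : {ffun 'I_2 -> 'S_n}) (a : 'I_2 * bool) (w : seq ('I_2 * bool)).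

(* In ['S_n], [(p * q) x = q (p x)]: a word acts by its letters from left to right. *)
Definition letter_perm u a : 'S_n := if a.2 then ((u a.1)^-1)%g else u a.1.

Definition word_perm u w : 'S_n := foldr (fun a p => (letter_perm u a * p)%g) 1%g w.

Definition trajectory u w (x : 'I_n) t := word_perm u (take t w) x.

Lemma letter_perm_inv u a : letter_perm u (letter_inv a) = ((letter_perm u a)^-1)%g.
Proof. by case: a => g []; rewrite /letter_perm /= ?invgK. Qed.

Lemma word_perm_cat u w1 w2 :
  word_perm u (w1 ++ w2) = (word_perm u w1 * word_perm u w2)%g.
Proof. by elim: w1 => [|a w1 IH] /=; rewrite ?mul1g // IH mulgA. Qed.

Lemma trajectoryS u w x t a0 : t < size w ->
  trajectory u w x t.+1 = letter_perm u (nth a0 w t) (trajectory u w x t).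
Proof.
by move=> tw; rewrite /trajectory (take_nth a0) // -cats1 word_perm_cat /= mulg1 permM.
Qed.

(** The side of the multiplication depends on the sign of [a], so that the letter [a] itself is
    always followed by the transposition of [z] and [y]: its edge into [z] now ends at [y]. *)
Definition swap_letter u a (z y : 'I_n) : {ffun 'I_2 -> 'S_n} :=
  [ffun g => if g == a.1 then
     if a.2 then (tperm z y * u g)%g else (u g * tperm z y)%g else u g].

Lemma swap_letterE u a z y :
  letter_perm (swap_letter u a z y) a = (letter_perm u a * tperm z y)%g.
Proof.
by case: a => g []; rewrite /letter_perm /= ffunE eqxx //= invMg tpermV.
Qed.

Lemma swap_letter_neq u a b z y : b.1 != a.1 ->
  letter_perm (swap_letter u a z y) b = letter_perm u b.
Proof. by move=> ba; rewrite /letter_perm ffunE (negPf ba). Qed.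

Lemma swap_letterK u a z y : swap_letter (swap_letter u a z y) a z y = u.
Proof.
apply/ffunP => g; rewrite !ffunE; case: eqP => // _; case: a.2.
  by rewrite mulgA tperm2 mul1g.
by rewrite -mulgA tperm2 mulg1.
Qed.

Definition first_return w x i j : {set {ffun 'I_2 -> 'S_n}} :=
  [set u | uniq [seq trajectory u w x t | t <- iota 0 i.+1] &
           trajectory u w x i.+1 == trajectory u w x j].

Lemma uniq_trajectoryP u w x i :
  reflect (forall s t, s <= i -> t <= i ->
             trajectory u w x s = trajectory u w x t -> s = t)
    (uniq [seq trajectory u w x t | t <- iota 0 i.+1]).
Proof.
apply: (iffP idP) => [U s t si ti e|H].
  have := nth_uniq (trajectory u w x 0) (s := [seq trajectory u w x t | t <- iota 0 i.+1])
    (i := s) (j := t).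
  rewrite size_map size_iota ltnS => /(_ si ti U).
  rewrite !(nth_map 0) ?size_iota ?ltnS // !nth_iota ?ltnS // !add0n e eqxx.
  by move/esym/eqP.
rewrite map_inj_in_uniq ?iota_uniq // => s t.
by rewrite !mem_iota !add0n !ltnS /= => si ti; exact: H.
Qed.

(* Redirecting the last step of the first return to a fresh point [y] does not
   disturb the earlier steps: they use other edges, because the word is reduced. *)
Lemma trajectory_swap a0 u w x i j y t : reduced w -> i < size w -> j <= i ->
  u \in first_return w x i j ->
  y \notin [seq trajectory u w x t | t <- iota 0 i.+1] -> t <= i ->
  trajectory (swap_letter u (nth a0 w i) (trajectory u w x j) y) w x t =
  trajectory u w x t.
Proof.
move=> rw iw ji; rewrite inE => /andP[/uniq_trajectoryP U /eqP ret] yP.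
have ny s : s <= i -> trajectory u w x s != y.
  move=> si; apply: contraNneq yP => <-; apply/mapP; exists s => //.
  by rewrite mem_iota.
set a := nth a0 w i in ret *; set z := trajectory u w x j in ret *.
have az : letter_perm u a (trajectory u w x i) = z by rewrite -trajectoryS.
elim: t => [_|t IH ti]; first by rewrite /trajectory !take0.
have tw : t < size w by lia.
have {}IH := IH (ltnW ti).
rewrite (trajectoryS _ _ a0 tw) IH.
rewrite (trajectoryS _ _ a0 tw).
set b := nth a0 w t.
have [ba|ba] := eqVneq b.1 a.1; last by rewrite swap_letter_neq.
have [bE|bE] := eqVneq b a.
  rewrite bE swap_letterE permM tpermD //; last first.
    by rewrite eq_sym -bE -trajectoryS // ny.
  rewrite eq_sym -az (inj_eq perm_inj) eq_sym.
  by apply/eqP => /U e; have := e (leqnn _) (ltnW ti); lia.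
have {}bE : b = letter_inv a.
  case: (b) (a) ba bE => [g s] [g' s'] /= -> ne; congr pair.
  by case: s s' ne => [] [] //=; rewrite eqxx.
rewrite bE !letter_perm_inv swap_letterE invMg permM tpermV tpermD //; last first.
  by rewrite eq_sym ny // ltnW.
(* If the point at time [t] were [z], the inverse edge would lead back to the point at time [i].
   Then t+1 = i, and the adjacent letters at [t] and [i] would cancel in the reduced word. *)
apply/eqP => e.
have : trajectory u w x t.+1 = trajectory u w x i.
  by rewrite (trajectoryS u _ a0) // -/b bE letter_perm_inv -e -az permK.
move/U => /(_ ti (leqnn _)) eti.
move/(sortedP a0): rw => /(_ t); rewrite eti => /(_ iw) /eqP; apply.
by rewrite -/b bE letter_invK.
Qed.

(** Rerouting is injective on pairs (u, y) with [y] fresh: the new trajectory shows [y] at time i+1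
    and the old target at time [j], and swapping twice restores [u]. Each [u] leaves at least n -
    (i+1) fresh points. *)
Lemma card_first_return w x i j : reduced w -> i < size w -> j <= i ->
  #|first_return w x i j| * (n - size w) <= #|{ffun 'I_2 -> 'S_n}|.
Proof.
move=> rw iw ji; case: w rw iw => // a0 w'; set w := a0 :: w' => rw iw.
pose D := [set uy : {ffun 'I_2 -> 'S_n} * 'I_n | (uy.1 \in first_return w x i j) &&
  (uy.2 \notin [seq trajectory uy.1 w x t | t <- iota 0 i.+1])].
pose f (uy : {ffun 'I_2 -> 'S_n} * 'I_n) :=
  swap_letter uy.1 (nth a0 w i) (trajectory uy.1 w x j) uy.2.
have tf uy t : uy \in D -> t <= i -> trajectory (f uy) w x t = trajectory uy.1 w x t.
  by rewrite inE => /andP[u1 u2] ti; exact: trajectory_swap.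
have yf uy : uy \in D -> uy.2 = trajectory (f uy) w x i.+1.
  move=> uD; rewrite (trajectoryS _ _ a0) // tf // swap_letterE permM.
  move: uD; rewrite !inE => /andP[/andP[_ /eqP]].
  by rewrite (trajectoryS _ _ a0) // => -> _; rewrite tpermL.
have finj : {in D &, injective f}.
  move=> u v uD vD e; have e2 : u.2 = v.2 by rewrite (yf u) // (yf v) // e.
  have ez : trajectory u.1 w x j = trajectory v.1 w x j.
    by rewrite -(tf u) // -(tf v) // e.
  rewrite [u]surjective_pairing [v]surjective_pairing e2; congr pair.
  rewrite -[u.1](swap_letterK _ (nth a0 w i) (trajectory u.1 w x j) u.2) -/(f u) e.
  by rewrite ez e2 swap_letterK.
apply: leq_trans (max_card (mem (f @: D))).
rewrite card_in_imset //.
have -> : #|D| = \sum_(u in first_return w x i j)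
    \sum_(y | y \notin [seq trajectory u w x t | t <- iota 0 i.+1]) 1.
  by rewrite pair_big_dep /= -sum1_card; apply: eq_bigl => p; rewrite inE.
rewrite -sum_nat_const; apply: leq_sum => u _; rewrite sum1_card.
set s := map _ _.
have sz : #|s| <= i.+1 by apply: leq_trans (card_size _) _; rewrite size_map size_iota.
have := cardC (mem s); rewrite card_ord => e.
have -> : #|[pred y | y \notin s]| = #|[predC s]| by apply: eq_card => y; rewrite !inE.
rewrite -{1}e leq_subLR leq_add2r (leq_trans sz) //.
Qed.

(** A fixed point forces the trajectory to meet itself, hence to have a first return, for one of at
    most |w|^2 pairs of times. *)
Lemma card_word_fix w x : reduced w -> w != [::] ->
  #|[set u | word_perm u w x == x]| * (n - size w) <=
  size w ^ 2 * #|{ffun 'I_2 -> 'S_n}|.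
Proof.
move=> rw w0.
have sub : [set u | word_perm u w x == x] \subset
    \bigcup_(ij : 'I_(size w) * 'I_(size w) | ij.2 <= ij.1) first_return w x ij.1 ij.2.
  apply/fintype.subsetP => u; rewrite inE => /eqP fx.
  pose P i := (i < size w) && [exists j : 'I_i.+1,
     trajectory u w x i.+1 == trajectory u w x j].
  have exP : exists i, P i.
    have sw : 0 < size w by rewrite lt0n size_eq0.
    (* The full word brings the trajectory back to its start, so the last step is a return to time
       0. *)
    exists (size w).-1; apply/andP; split; first by rewrite prednK.
    apply/existsP; exists ord0.
    by rewrite /= prednK // /trajectory take_size take0 /= fx perm1.
  case: (ex_minnP exP) => i /andP[iw /existsP[j /eqP ej]] imin.
  have jw : j < size w by apply: leq_trans (ltn_ord j) iw.
  apply/bigcupP; exists (Ordinal iw, Ordinal jw); first by rewrite /= -ltnS.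
  rewrite inE /= ej eqxx andbT; apply/uniq_trajectoryP.
  have H s t : s < t -> t <= i -> trajectory u w x s <> trajectory u w x t.
    case: t => // t st ti e; have := imin t; rewrite [i <= t]leqNgt ti => H.
    suff: false by []. apply: H; rewrite /P; rewrite (leq_trans _ iw) ?ltnS ?(ltnW ti) //=.
    by apply/existsP; exists (Ordinal st); rewrite /= e.
  move=> s t si ti e; case: (ltngtP s t) => // st.
    by case: (H _ _ st ti).
  by case: (H _ _ st si).
apply: leq_trans (leq_mul (subset_leq_card sub) (leqnn _)) _.
apply: leq_trans (leq_mul (leq_card_bigcup _ _) (leqnn _)) _.
rewrite big_distrl /=.
apply: (@leq_trans (\sum_(ij : 'I_(size w) * 'I_(size w) | ij.2 <= ij.1)
   #|{ffun 'I_2 -> 'S_n}|)).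
  by apply: leq_sum => -[i j] /= ji; exact: card_first_return.
rewrite sum_nat_const leq_mul //.
by apply: leq_trans (max_card _) _; rewrite card_prod !card_ord.
Qed.

(** Markov's inequality for the number of fixed points, whose sum over [u] is computed by double
    counting pairs (u, x). *)
Lemma card_word_many_fix w M : reduced w -> w != [::] -> 0 < n ->
  #|[set u | n <= M * #|[set x | word_perm u w x == x]|]| * (n - size w) <=
  M * size w ^ 2 * #|{ffun 'I_2 -> 'S_n}|.
Proof.
move=> rw w0 n0; rewrite -(leq_pmul2l n0).
set bad := [set u | _].
have nbad : n * #|bad| <= \sum_u M * #|[set x | word_perm u w x == x]|.
  rewrite mulnC -sum_nat_const big_mkcond leq_sum // => u _.
  by rewrite inE; case: ifP.
have sumE : \sum_u #|[set x | word_perm u w x == x]| =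
            \sum_(x : 'I_n) #|[set u | word_perm u w x == x]|.
  under eq_bigr do rewrite -sum1_card big_mkcond /=.
  rewrite exchange_big; apply: eq_bigr => x _.
  rewrite -sum1_card [RHS]big_mkcond /=; apply: eq_bigr => u _; by rewrite !inE.
rewrite mulnA; apply: leq_trans (leq_mul nbad (leqnn _)) _.
rewrite -big_distrr /= sumE -mulnA big_distrl /=.
rewrite [leqRHS](_ : _ = M * (n * (size w ^ 2 * #|{ffun 'I_2 -> 'S_n}|))); last by lia.
rewrite leq_mul2l; apply/orP; right.
have -> X : n * X = \sum_(x : 'I_n) X by rewrite sum_nat_const card_ord.
by apply: leq_sum => x _; exact: card_word_fix.
Qed.

End Trajectory.

(** * Expansion *)

(** List each set followed by its complement, and match the two lists position by position. *)
Lemma exists_perm_imset (T : finType) (A B : {set T}) : #|A| = #|B| ->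
  exists p : {perm T}, p @: A = B.
Proof.
move=> AB.
pose e (X : {set T}) := enum X ++ enum (~: X).
have eU X : uniq (e X).
  rewrite cat_uniq !enum_uniq andbT /=; apply/hasPn => x.
  by rewrite !mem_enum inE.
have eT X x : x \in e X by rewrite mem_cat !mem_enum inE orbN.
have es X : size (e X) = #|T|.
  by rewrite size_cat -!cardE cardsC.
pose f x := nth x (e B) (index x (e A)).
have finj : injective f.
  move=> x y; rewrite /f (set_nth_default x y) ?es -?(es A) ?index_mem // => /eqP.
  rewrite nth_uniq ?eU ?es -?(es A) ?index_mem // => /eqP h.
  by rewrite -(nth_index x (eT A x)) h nth_index.
exists (perm finj); apply/eqP; rewrite eqEcard card_imset ?AB ?leqnn ?andbT; last exact: perm_inj.
apply/fintype.subsetP => _ /imsetP[x xA ->]; rewrite permE /f.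
have ix : index x (e A) < #|B|.
  by rewrite index_cat mem_enum xA -AB cardE index_mem mem_enum.
by rewrite nth_cat -cardE ix -mem_enum mem_nth // -cardE.
Qed.

(** * Images of a set under a random permutation *)

Section ExpanderCount.
Context (n : nat).
Implicit Types (A B : {set 'I_n}) (p : 'S_n) (u : {ffun 'I_2 -> 'S_n}).

(** Translating by a permutation that carries [B] to [B'] shows that all targets of the right size
    are hit equally often; there are 'C(n, |A|) of them. *)
Lemma card_perm_imset_eq A B : #|A| = #|B| ->
  #|[set p : 'S_n | p @: A == B]| * 'C(n, #|A|) = n`!.
Proof.
move=> AB.
have cst B' : #|B'| == #|A| ->
    #|[set p : 'S_n | p @: A == B']| = #|[set p : 'S_n | p @: A == B]|.
  move=> /eqP B'A; have [s sE] := @exists_perm_imset _ B B' (etrans (esym AB) (esym B'A)).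
  rewrite -(card_imset [set p : 'S_n | p @: A == B] (@mulIg _ s)).
  apply: eq_card => p; rewrite inE; apply/eqP/imsetP => [pA|[q]]; last first.
    rewrite inE => /eqP qA ->; rewrite -sE -qA -imset_comp.
    by apply: eq_imset => x; rewrite permM.
  exists (p * s^-1)%g; last by rewrite mulgKV.
  rewrite inE; apply/eqP; rewrite (eq_imset _ (permM p s^-1)) imset_comp pA -sE -imset_comp.
  by rewrite -[RHS]imset_id; apply: eq_imset => x /=; rewrite permK.
rewrite -[in RHS]card_Sn -[in RHS]sum1_card.
rewrite (partition_big (fun p : 'S_n => p @: A) (fun B' => #|B'| == #|A|)) /=; last first.
  by move=> p _; rewrite card_imset //; exact: perm_inj.
have := card_draws 'I_n #|A|; rewrite card_ord mulnC => <-.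
rewrite -sum_nat_const [RHS](eq_bigl (fun B' => B' \in
   [set B' : {set 'I_n} | #|B'| == #|A|])); last by move=> B'; rewrite inE.
apply: eq_bigr => B'; rewrite inE => /cst <-; rewrite -sum1_card; apply: eq_bigl => p.
by rewrite inE.
Qed.

Lemma card_small_subsets A t :
  #|[set D : {set 'I_n} | D \subset A & #|D| <= t]| = \sum_(j < t.+1) 'C(#|A|, j).
Proof.
rewrite -sum1_card (partition_big (fun D : {set 'I_n} => inord #|D| : 'I_t.+1) xpredT) //=.
apply: eq_bigr => j _; rewrite -cards_draws -sum1_card; apply: eq_bigl => D.
rewrite !inE -andbA; congr (_ && _); apply/andP/eqP => [[Dt /eqP <-]|Dj].
  by rewrite inordK.
by split; [rewrite Dj -ltnS | apply/eqP/val_inj; rewrite /= inordK Dj].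
Qed.

(** Counts the ways to remove at most [t] points from an m-set and to add at most [t] points of its
    complement. *)
Definition swap_sets_bound m t :=
  (\sum_(j < t.+1) 'C(m, j)) * (\sum_(j < t.+1) 'C(n - m, j)).

(** [B] is determined by the two differences A \ B and B \ A, which have equal size because |A| =
    |B|. *)
Lemma card_close_sets A t :
  #|[set B : {set 'I_n} | #|B| == #|A| & #|B :\: A| <= t]| <= swap_sets_bound #|A| t.
Proof.
rewrite /swap_sets_bound -card_small_subsets.
have -> : n - #|A| = #|~: A| by have := cardsC A; rewrite card_ord; lia.
rewrite -card_small_subsets -cardsX.
have finj : injective (fun B => (A :\: B, B :\: A)).
  move=> B C [e1 e2]; apply/setP => x; move/setP/(_ x): e1; move/setP/(_ x): e2.
  by rewrite !inE; case: (x \in A); case: (x \in B); case: (x \in C).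
rewrite -(card_imset _ finj); apply: subset_leq_card; apply/fintype.subsetP => _ /imsetP[B + ->].
rewrite inE => /andP[/eqP BA Bt]; rewrite !inE subsetDl Bt andbT /=.
have -> : #|A :\: B| = #|B :\: A|.
  have := cardsID B A; have := cardsID A B; rewrite BA finset.setIC; lia.
by rewrite Bt /=; apply/fintype.subsetP => x; rewrite !inE => /andP[].
Qed.

Lemma card_almost_invariant A t :
  #|[set p : 'S_n | #|p @: A :\: A| <= t]| * 'C(n, #|A|) <= swap_sets_bound #|A| t * n`!.
Proof.
have -> : #|[set p : 'S_n | #|p @: A :\: A| <= t]| =
    \sum_(B in [set B : {set 'I_n} | #|B| == #|A| & #|B :\: A| <= t])
      #|[set p : 'S_n | p @: A == B]|.
  rewrite -sum1_card (partition_big (fun p : 'S_n => p @: A)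
     (fun B => B \in [set B : {set 'I_n} | #|B| == #|A| & #|B :\: A| <= t])) /=; last first.
    by move=> p; rewrite !inE => ->; rewrite card_imset ?eqxx //; exact: perm_inj.
  apply: eq_bigr => B; rewrite inE => /andP[_ Bt]; rewrite -sum1_card; apply: eq_bigl => p.
  by rewrite !inE; case: eqP => [->|]; rewrite ?Bt ?andbF.
rewrite big_distrl /= (eq_bigr (fun=> n`!)); last first.
  by move=> B; rewrite inE => /andP[/eqP BA _]; rewrite card_perm_imset_eq.
by rewrite sum_nat_const leq_mul // card_close_sets.
Qed.

(** The sets [A] stand for the diagonal projections of trace in (0, 1/2], which turns failure of
    expansion into a counting problem. *)
Definition non_expander K := [set u : {ffun 'I_2 -> 'S_n} | [exists A : {set 'I_n},
  [&& 0 < #|A|, 2 * #|A| <= n & [forall g, K * #|u g @: A :\: A| <= #|A|]]]].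

(** Union bound over [A]; the square comes from the independent choice of the two permutations. *)
Lemma card_non_expander K : 0 < K ->
  #|non_expander K| <= \sum_(A : {set 'I_n} | (0 < #|A|) && (2 * #|A| <= n))
    #|[set p : 'S_n | #|p @: A :\: A| <= #|A| %/ K]| ^ 2.
Proof.
move=> K0.
have sub : non_expander K \subset
  \bigcup_(A : {set 'I_n} | (0 < #|A|) && (2 * #|A| <= n))
    [set u : {ffun 'I_2 -> 'S_n} | [forall g, K * #|u g @: A :\: A| <= #|A|]].
  apply/fintype.subsetP => u; rewrite inE => /existsP[A /and3P[A0 An uA]].
  by apply/bigcupP; exists A; rewrite ?A0 ?inE.
apply: leq_trans (subset_leq_card sub) _.
apply: leq_trans (leq_card_bigcup _ _) _; apply: leq_sum => A _.
rewrite -[in X in _ ^ X](card_ord 2) -card_ffun_on; apply: subset_leq_card.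
apply/fintype.subsetP => u; rewrite inE => /forallP uA; apply/ffun_onP => g.
by rewrite inE leq_divRL // mulnC.
Qed.

End ExpanderCount.

(** * Numerical estimates for the union bound *)

Section Estimates.
Local Open Scope ring_scope.
Context (R : realType).

Lemma sum_binomial_le (y : R) m t : 0 <= y <= 1 -> (t <= m)%N ->
  y ^+ t * (\sum_(j < t.+1) 'C(m, j))%:R <= (1 + y) ^+ m.
Proof.
move=> /andP[y0 y1] tm.
(* Chernoff: [y ^ t <= y ^ j] for [j <= t], then the binomial theorem. *)
rewrite natr_sum big_distrr /= addrC exprD1n.
have tm' : (t < m.+1)%N by [].
rewrite (big_ord_widen _ (fun j => y ^+ t * 'C(m, j)%:R) tm') big_mkcond /=.
apply: ler_sum => j _; rewrite -[leRHS]mulr_natr; case: ifP => jt; last first.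
  by rewrite mulr_ge0 ?exprn_ge0.
by rewrite ler_wpM2r // ler_wiXn2l.
Qed.

(** Induction through 'C(n+1, m+1) = (n+1)/(m+1) 'C(n, m), using (n+1)/(m+1) <= n/m for m <= n. *)
Lemma binomial_ge (n m : nat) : (m <= n)%N -> (n%:R / m%:R) ^+ m <= 'C(n, m)%:R :> R.
Proof.
elim: m n => [n _|m IH [|n] // mn]; first by rewrite bin0 expr0.
rewrite exprS.
have mn0 : (m.+1%:R : R) != 0 by rewrite pnatr_eq0.
have -> : 'C(n.+1, m.+1)%:R = (n.+1%:R / m.+1%:R) * 'C(n, m)%:R :> R.
  apply: (mulfI mn0); rewrite -natrM -mul_bin_diag natrM; field.
  by rewrite nat1r pnatr_eq0.
rewrite ler_wpM2l ?mulr_ge0 ?invr_ge0 //; apply: le_trans (IH _ mn).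
case: m mn {IH mn0} => [|m] mn; first by rewrite !expr0.
rewrite lerXn2r ?nnegrE ?mulr_ge0 ?invr_ge0 //.
rewrite ler_pdivrMr ?ltr0n // mulrAC ler_pdivlMr ?ltr0n // -!natrM ler_nat.
by nia.
Qed.

Lemma expR_inv8 : expR (8^-1 : R) <= 8 / 7.
Proof.
have h := expR_ge1Dx (- 8^-1 : R).
have p := expR_gt0 (8^-1 : R).
have e : expR (8^-1 : R) * expR (- 8^-1) = 1 by rewrite -expRD subrr expR0.
have : expR (8^-1 : R) * (7 / 8) <= 1.
  by rewrite -[leRHS]e ler_pM2l //; apply: le_trans h; lra.
lra.
Qed.

Lemma expr1D_le_expR (x : R) k : 0 <= 1 + x -> (1 + x) ^+ k <= expR (k%:R * x).
Proof.
by move=> x0; rewrite expRM_natl lerXn2r ?nnegrE ?expR_ge0 // expR_ge1Dx.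
Qed.

(** After cancelling r^(2t) the worst case is r = 2. There 2048^(2t) = 2^(22t) is at most (6/5)^m,
    and (6/5)(8/7) <= (7/10) 2. *)
Lemma exponential_comparison (r : R) (m t : nat) : 2 <= r -> (88 * t <= m)%N ->
  (1024 * r) ^+ (2 * t) * (8 / 7) ^+ m <= (7 / 10) ^+ m * r ^+ m.
Proof.
move=> r2 tm; have tm2 : (2 * t <= m)%N by lia.
have r0 : 0 <= r by lra.
rewrite -[in r ^+ m](subnKC tm2) exprD exprMn [leRHS]mulrCA [_ * r ^+ _]mulrC -[leLHS]mulrA.
rewrite ler_wpM2l ?exprn_ge0 ?r0 //.
apply: (@le_trans _ _ ((7 / 10) ^+ m * 2 ^+ (m - 2 * t))); last first.
  by rewrite ler_wpM2l ?exprn_ge0 // ?lerXn2r ?nnegrE ?r0 //; lra.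
have p2 : 0 < (2 : R) ^+ (2 * t) by rewrite exprn_gt0.
rewrite -(ler_pM2r p2) -[leRHS]mulrA -exprD subnK //.
rewrite mulrAC -exprMn.
have -> : (1024 * 2 : R) ^+ (2 * t) = (2 ^+ 22) ^+ t.
  by rewrite exprM; congr (_ ^+ _); ring.
apply: (@le_trans _ _ ((6 / 5) ^+ m * (8 / 7) ^+ m)).
  rewrite ler_wpM2r ?exprn_ge0 //.
  apply: (@le_trans _ _ ((6 / 5) ^+ (88 * t))); last by rewrite ler_weXn2l //; lra.
  rewrite exprM lerXn2r ?nnegrE ?exprn_ge0 //.
  (* The factorisation reduces the claim to 2 <= (6/5)^4. *)
  have -> : 88%N = (4 * 22)%N by [].
    rewrite exprM lerXn2r ?nnegrE ?exprn_ge0 //.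
  by rewrite -subr_ge0; lra.
rewrite -!exprMn lerXn2r ?nnegrE //; lra.
Qed.

(* The divisor 88 of [m] is chosen so that 2^22 <= (6/5)^88. *)
Lemma swap_sets_bound_sqr_le (n m t : nat) : (0 < m)%N -> (2 * m <= n)%N -> (88 * t <= m)%N ->
  (swap_sets_bound n m t)%:R ^+ 2 <= (7 / 10) ^+ m * 'C(n, m)%:R :> R.
Proof.
move=> m0 mn tm.
have tm2 : (2 * t <= m)%N by lia.
have mn1 : (m <= n)%N by lia.
have tmn : (t <= n - m)%N by lia.
have tm1 : (t <= m)%N by lia.
have n0 : (0 < n)%N by lia.
have nR : 0 < n%:R :> R by rewrite ltr0n.
have mR : 0 < m%:R :> R by rewrite ltr0n.
have [r rE] : exists r : R, r = n%:R / m%:R by eexists.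
have r2 : 2 <= r by rewrite rE ler_pdivlMr // -natrM ler_nat.
have r0 : 0 < r by lra.
(* Chernoff parameters for the two binomial sums, balanced so that m y1 = n y2 = m/32. The squared
   product then costs exp(m/8) <= (8/7)^m, and 1/(y1 y2) = 1024 r. *)
pose y1 : R := 32^-1; pose y2 : R := 32^-1 * r^-1.
have y1ge : 0 <= y1 by rewrite invr_ge0.
have y2ge : 0 < y2 by rewrite mulr_gt0 ?invr_gt0.
have y2le : y2 <= 1.
  by rewrite /y2 -invfM invf_le1 ?mulr_gt0 //; nra.
set S1 := (\sum_(j < t.+1) 'C(m, j))%N; set S2 := (\sum_(j < t.+1) 'C(n - m, j))%N.
have b1 : y1 ^+ t * S1%:R <= expR (m%:R * y1).
  apply: le_trans (expr1D_le_expR _ _); last by rewrite /y1; lra.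
  by apply: sum_binomial_le; rewrite // y1ge invf_le1; lra.
have b2 : y2 ^+ t * S2%:R <= expR (m%:R * y1).
  have -> : m%:R * y1 = n%:R * y2 by rewrite /y2 rE /y1; field; rewrite !gt_eqF.
  apply: le_trans (expr1D_le_expR _ _); last by rewrite addr_ge0 // ltW.
  apply: (@le_trans _ _ ((1 + y2) ^+ (n - m))).
    by apply: sum_binomial_le; rewrite // ltW.
  by rewrite ler_weXn2l ?leq_subr // lerDl ltW.
have b : (y1 * y2) ^+ (2 * t) * (swap_sets_bound n m t)%:R ^+ 2 <= (8 / 7) ^+ m.
  apply: (@le_trans _ _ (expR (m%:R * y1) ^+ 4)).
    have -> : (y1 * y2) ^+ (2 * t) * (swap_sets_bound n m t)%:R ^+ 2 =
       ((y1 ^+ t * S1%:R) * (y2 ^+ t * S2%:R)) ^+ 2.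
      by rewrite /swap_sets_bound natrM -/S1 -/S2 mulnC exprM !exprMn; ring.
    rewrite [leRHS](exprM _ 2 2) lerXn2r ?nnegrE ?sqr_ge0 //.
      by rewrite mulr_ge0 // mulr_ge0 ?exprn_ge0 // ltW.
    by rewrite expr2 ler_pM ?mulr_ge0 ?exprn_ge0 // ltW.
  rewrite -expRM_natl.
  have -> : 4%:R * (m%:R * y1) = m%:R * 8^-1 by rewrite /y1; field.
  by rewrite expRM_natl lerXn2r ?nnegrE ?expR_ge0 ?expR_inv8 //; lra.
have c := exponential_comparison r2 tm.
apply: le_trans (_ : (7 / 10) ^+ m * r ^+ m <= _); last first.
  by rewrite rE ler_wpM2l ?exprn_ge0 ?binomial_ge.
apply: le_trans c.
have -> : (swap_sets_bound n m t)%:R ^+ 2 = (1024 * r) ^+ (2 * t) *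
   ((y1 * y2) ^+ (2 * t) * (swap_sets_bound n m t)%:R ^+ 2) :> R.
  rewrite mulrA -exprMn (_ : 1024 * r * (y1 * y2) = 1) ?expr1n ?mul1r //.
  by rewrite /y1 /y2; field; rewrite gt_eqF.
have k0 : 0 <= 1024 * r by rewrite pmulr_rge0 ?ltr0n ?(ltW r0).
apply: ler_wpM2l b; exact: exprn_ge0.
Qed.

Lemma bin_ge_n (n m : nat) : (0 < m < n)%N -> (n <= 'C(n, m))%N.
Proof.
elim: n m => [|n IH] [|m] //=; rewrite ltnS => mn.
case: (ltnP m.+1 n) => mn'; first by rewrite binS -addn1 leq_add ?IH ?bin_gt0 // ltnW.
by rewrite (_ : m.+1 = n) ?binSn //; lia.
Qed.

Lemma sum_card_subsets (n : nat) (P : pred nat) (f : nat -> R) :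
  \sum_(A : {set 'I_n} | P #|A|) f #|A| = \sum_(m < n.+1 | P m) 'C(n, m)%:R * f m.
Proof.
have cA (A : {set 'I_n}) : (#|A| < n.+1)%N by rewrite ltnS -[leqRHS]card_ord max_card.
rewrite (partition_big (fun A : {set 'I_n} => Ordinal (cA A)) (fun m : 'I_n.+1 => P m)) //=.
apply: eq_bigr => m Pm; have := card_draws 'I_n m; rewrite card_ord => <-.
rewrite mulr_natl -sumr_const; apply: eq_big => A.
  by rewrite inE -val_eqE /=; case: eqP => [->|]; rewrite ?Pm ?andbF.
by move=> /andP[_ /eqP <-].
Qed.

Lemma geometric_tail (N a : nat) :
  \sum_(m < N + a | (a <= m)%N) (7 / 10 : R) ^+ m <= (7 / 10) ^+ a * (10 / 3).
Proof.
suff -> : \sum_(m < N + a | (a <= m)%N) (7 / 10 : R) ^+ m =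
    ((7 / 10) ^+ a - (7 / 10) ^+ (N + a)) * (10 / 3).
  have : 0 <= (7 / 10 : R) ^+ (N + a) by rewrite exprn_ge0.
  lra.
elim: N => [|N IH].
  by rewrite subrr mul0r big1 // => -[m ma] /= am; lia.
rewrite addSn big_mkcond big_ord_recr -big_mkcond /= IH leq_addl exprS; lra.
Qed.

(** One factor 1/'C(n, m) of the squared proportion cancels the number of m-sets, which leaves the
    sum of the weights [w m]. Sizes below 88 give at most 88/n <= 11/100, the others a geometric
    tail of at most 1/10. *)
Lemma card_non_expander_le (n : nat) : (800 <= n)%N ->
  (4 * #|non_expander n 88| <= n`! ^ 2)%N.
Proof.
move=> n800; rewrite -(ler_nat R).
have n0 : 0 < n%:R :> R by rewrite ltr0n; lia.
pose P m := ((0 < m) && (2 * m <= n))%N.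
(* For m < 88 the tolerance [m %/ 88] is 0, so only [A] itself is close to [A], and 1/'C(n, m) <=
   1/n suffices. *)
pose w m : R := if (m < 88)%N then n%:R^-1 else (7 / 10) ^+ m.
have key (A : {set 'I_n}) : P #|A| ->
    (#|[set p : 'S_n | (#|p @: A :\: A| <= #|A| %/ 88)%N]| ^ 2)%:R <=
    (n`!%:R ^+ 2 * w #|A|) / 'C(n, #|A|)%:R :> R.
  move=> /andP[m0 mn]; set q := #|[set p | _]|; set m := #|A| in m0 mn *.
  have C0 : 0 < 'C(n, m)%:R :> R by rewrite ltr0n bin_gt0; lia.
  have Sw : (swap_sets_bound n m (m %/ 88))%:R ^+ 2 <= w m * 'C(n, m)%:R.
    rewrite /w; case: ltnP => m88; last by apply: swap_sets_bound_sqr_le; lia.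
    rewrite divn_small // /swap_sets_bound !big_ord_recl !big_ord0 !bin0 expr1n.
    by rewrite mulrC ler_pdivlMr // mul1r ler_nat bin_ge_n //; lia.
  rewrite ler_pdivlMr // -(ler_pM2r C0) natrX.
  have /(_ (m %/ 88)%N) := @card_almost_invariant n A.
  rewrite -/m -/q -(ler_nat R) natrM [leRHS]natrM => h.
  apply: (@le_trans _ _ ((swap_sets_bound n m (m %/ 88))%:R ^+ 2 * n`!%:R ^+ 2)).
    by rewrite -mulrA -expr2 -!exprMn lerXn2r ?nnegrE ?mulr_ge0 //.
  by rewrite [leLHS]mulrC -[leRHS]mulrA ler_wpM2l ?exprn_ge0.
have := @card_non_expander n 88 isT; rewrite -(ler_nat R) natr_sum => ne.
rewrite natrM -ler_pdivlMl //; apply: le_trans ne _.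
apply: le_trans (ler_sum _ key) _.
rewrite (sum_card_subsets n P (fun m => n`!%:R ^+ 2 * w m / 'C(n, m)%:R)).
apply: (@le_trans _ _ (\sum_(m < n.+1) n`!%:R ^+ 2 *
    ((if (m < 88)%N then n%:R^-1 else 0) + (if (88 <= m)%N then (7 / 10) ^+ m else 0)))).
  rewrite big_mkcond; apply: ler_sum => m _; case: ifP => [/andP[m0 mn]|_].
    rewrite [leLHS]mulrCA divff ?mulr1; last by rewrite pnatr_eq0 -lt0n bin_gt0; lia.
    by rewrite /w [(88 <= m)%N]leqNgt; case: ifP => _; rewrite ?addr0 ?add0r.
  by rewrite mulr_ge0 ?exprn_ge0 ?addr_ge0 //; case: ifP => // _; rewrite ?invr_ge0 ?exprn_ge0 // ltW.
rewrite -big_distrr /= natrX mulrC ler_wpM2r ?exprn_ge0 // big_split /=.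
rewrite -!big_mkcond /=.
have -> : \sum_(m < n.+1 | (m < 88)%N) n%:R^-1 = 88 / n%:R :> R.
  have h : (88 <= n.+1)%N by lia.
  by rewrite -(big_ord_widen _ (fun=> n%:R^-1 : R) h) sumr_const card_ord mulr_natl.
have -> : n.+1 = (n.+1 - 88 + 88)%N by lia.
have h1 := geometric_tail (n.+1 - 88) 88.
have h2 : (7 / 10 : R) ^+ 88 <= (7 / 10) ^+ 12 by rewrite ler_wiXn2l //; lra.
have h3 : (7 / 10 : R) ^+ 12 <= 3 / 100 by rewrite -subr_ge0; lra.
have h4 : 88 / n%:R <= 11 / 100 :> R.
  rewrite ler_pdivrMr //.
  have : 800%:R <= n%:R :> R by rewrite ler_nat.
  lra.
lra.
Qed.

End Estimates.

(** * Pairs far from being conjugate *)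

Lemma card_ffun_perm n : #|{ffun 'I_2 -> 'S_n}| = n`! ^ 2.
Proof. by rewrite card_ffun card_ord card_Sn. Qed.

Lemma exists_superset_card (T : finType) (S : {set T}) d : #|S| <= d <= #|T| ->
  exists2 D : {set T}, S \subset D & #|D| = d.
Proof.
move=> /andP[Sd dT].
have : 0 < #|[set D : {set T} | D \subset ~: S & #|D| == #|T| - d]|.
  by rewrite cards_draws bin_gt0; have := cardsC S; lia.
case/card_gt0P => D; rewrite inE => /andP[DS /eqP Dc].
by exists (~: D); [rewrite -finset.setCS finset.setCK | have := cardsC D; lia].
Qed.

Section Balls.
Context (n : nat).
Implicit Types (p q r : 'S_n) (u v : {ffun 'I_2 -> 'S_n}).

Definition perm_dist p q := #|[set i | p i != q i]|.

(** The quotient of [q] by [p] is supported on some d-set, and 'C(n, d) d! = n^_d. *)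
Lemma card_ball p d : d <= n -> #|[set q | perm_dist p q <= d]| <= n ^_ d.
Proof.
move=> dn.
have sub : [set q * p^-1 | q in [set q | perm_dist p q <= d]]%g \subset
    \bigcup_(D : {set 'I_n} | #|D| == d) [set s | perm_on D s].
  apply/fintype.subsetP => _ /imsetP[q + ->]; rewrite inE => qd.
  have dn' : perm_dist p q <= d <= #|'I_n| by rewrite qd card_ord.
  have [D SD Dd] := exists_superset_card dn'.
  apply/bigcupP; exists D; first exact/eqP.
  rewrite inE; apply/fintype.subsetP => i; rewrite inE permM => qi.
  apply: (fintype.subsetP SD); rewrite inE; apply: contraNneq qi => <-.
  by rewrite permK.
rewrite -(card_imset _ (@mulIg _ p^-1%g)); apply: leq_trans (subset_leq_card sub) _.
apply: leq_trans (leq_card_bigcup _ _) _.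
rewrite (eq_bigr (fun=> d`!)) => [|D /eqP Dd]; last by rewrite cardsE card_perm Dd.
rewrite sum_nat_const -bin_ffact leq_mul2r; apply/orP; right.
by have := card_draws 'I_n d; rewrite card_ord => <-; rewrite cardsE.
Qed.

Definition near_conjugates d u := [set v : {ffun 'I_2 -> 'S_n} |
  [exists r : 'S_n, forall g, perm_dist (r * u g * r^-1)%g (v g) <= d]].

Lemma card_near_conjugates d u : d <= n ->
  #|near_conjugates d u| <= n`! * (n ^_ d) ^ 2.
Proof.
move=> dn.
pose F (r : 'S_n) (g : 'I_2) := [set q | perm_dist (r * u g * r^-1)%g q <= d].
have sub : near_conjugates d u \subset \bigcup_(r : 'S_n) [set v | v \in family (F r)].
  apply/fintype.subsetP => v; rewrite inE => /existsP[r /forallP rP].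
  by apply/bigcupP; exists r => //; rewrite inE; apply/familyP => g; rewrite inE.
apply: leq_trans (subset_leq_card sub) _; apply: leq_trans (leq_card_bigcup _ _) _.
rewrite -[n`!]card_Sn -sum_nat_const; apply: leq_sum => r _.
rewrite cardsE card_family foldrE big_map big_enum /= big_ord_recl big_ord1.
by rewrite -mulnn leq_mul // card_ball.
Qed.

End Balls.

Lemma ffact_ge (m k : nat) : (m - k) ^ k <= m ^_ k.
Proof.
elim: k m => [|k IH] [|m] //; rewrite ?expn0 ?ffactn0 ?exp0n //.
rewrite ffactSS expnS subSS leq_mul //; first lia.
Qed.

(** Cancelling n^_d from n! leaves C n^_d <= (n-d)!. The left side is at most C (8d)^d, the right
    side at least (3d)! >= d^(2d), and 8C <= d. *)
Lemma ffact_sqr_le_fact C n : 32 * C + 4 <= n -> C * (n ^_ (n %/ 4)) ^ 2 <= n`!.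
Proof.
move=> nC; set d := n %/ 4.
have dn : d <= n by lia.
rewrite -(ffact_fact dn) -mulnn mulnCA leq_mul2l; apply/orP; right.
have [->|C0] := posnP C; first by rewrite mul0n.
have d0 : 0 < d by lia.
have h1 : n ^_ d <= (8 * d) ^ d.
  apply: leq_trans (_ : n ^ d <= _); last by rewrite leq_exp2r //; lia.
  by elim: (d) => [|k IH]; rewrite ?ffactn0 // ffactnSr expnSr leq_mul // leq_subr.
have h2 : d ^ (2 * d) <= (n - d)`!.
  apply: leq_trans (_ : (3 * d)`! <= _); last by apply: leq_fact; lia.
  have d3 : 2 * d <= 3 * d by lia.
  rewrite -(ffact_fact d3).
  apply: leq_trans (leq_pmulr _ (fact_gt0 _)).
  by apply: leq_trans (ffact_ge _ _); rewrite leq_exp2r //; lia.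
apply: leq_trans h2; apply: leq_trans (leq_mul (leqnn C) h1) _.
rewrite mulnC expnMn mulnAC mul2n -addnn expnD leq_mul2r; apply/orP; right.
apply: (@leq_trans ((8 * C) ^ d)); last by rewrite leq_exp2r //; lia.
rewrite expnMn leq_mul2l; apply/orP; right.
by rewrite -[leqLHS]expn1 leq_pexp2l.
Qed.

(** * Greedy choice of good pairs *)

Lemma greedy_family (T : finType) (G : {set T}) (N : T -> {set T}) B k :
  (forall u, #|N u| <= B) -> k * B < #|G| ->
  exists v : nat -> T, (forall s, s <= k -> v s \in G) /\
    (forall s t, s < t -> t <= k -> v t \notin N (v s)).
Proof.
move=> NB; elim: k => [|k IH] kG.
  have /card_gt0P[u uG] : 0 < #|G| by [].
  by exists (fun=> u); split=> // s t st; rewrite leqn0 => /eqP t0; rewrite t0 in st.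
have [|v [vG vN]] := IH; first by apply: leq_ltn_trans kG; rewrite leq_mul2r leqnSn orbT.
have cU : #|\bigcup_(s < k.+1) N (v s)| <= k.+1 * B.
  apply: leq_trans (leq_card_bigcup _ _) _.
  rewrite -[k.+1 in leqRHS]card_ord -sum_nat_const; exact: leq_sum.
have /card_gt0P[x] : 0 < #|G :\: \bigcup_(s < k.+1) N (v s)|.
  rewrite cardsD subn_gt0; apply: leq_ltn_trans kG; apply: leq_trans cU.
  by rewrite subset_leq_card ?finset.subsetIr.
rewrite inE => /andP[xU xG].
exists (fun s => if s <= k then v s else x); split=> [s sk|s t st tk].
  by case: ifP => // /vG.
have sk : s <= k by lia.
rewrite sk; case: ifP => tk'; first exact: vN.
apply: contraNN xU => xN; apply/bigcupP.
have sk' : s < k.+1 by [].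
by exists (Ordinal sk').
Qed.

Lemma card_words_many_fix (ws : seq (seq ('I_2 * bool))) M Q :
  all (fun w => reduced w && (w != [::])) ws ->
  exists n0, forall n, n0 <= n ->
    Q * #|[set u : {ffun 'I_2 -> 'S_n} |
      has (fun w => n <= M * #|[set x | word_perm u w x == x]|) ws]| <= n`! ^ 2.
Proof.
elim: ws Q => [|w ws IH] Q /=.
  by exists 0 => n _; rewrite eq_card0 ?muln0 // => u; rewrite inE.
(* Doubling [Q] splits the allowance evenly between the head word and the remaining ones. *)
move=> /andP[/andP[rw w0] /(IH (2 * Q))[n1 Hn1]].
pose X := M * size w ^ 2.
(* This makes n - |w| at least 2Q(X+1); the successor keeps the factor cancelled below positive,
   since [X] vanishes when M = 0. *)
exists (maxn n1 (size w + 2 * Q * X.+1 + 1)) => n; rewrite geq_max => /andP[nn1 nn].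
have n0 : 0 < n by lia.
have h1 := Hn1 _ nn1; have h2 := @card_word_many_fix n w M rw w0 n0.
rewrite card_ffun_perm -/X in h2.
set S1 := [set u | _] in h1; set S2 := [set u | _] in h2.
have h3 : #|[set u : {ffun 'I_2 -> 'S_n} |
    (n <= M * #|[set x | word_perm u w x == x]|)
    || has (fun w => n <= M * #|[set x | word_perm u w x == x]|) ws]| <= #|S2| + #|S1|.
  apply: leq_trans (leq_card_setU S2 S1); apply: subset_leq_card.
  by apply/fintype.subsetP => u; rewrite !inE.
have h4 : 2 * Q * #|S2| <= n`! ^ 2.
  rewrite -(@leq_pmul2l X.+1) //.
  apply: leq_trans (_ : X * n`! ^ 2 <= _); last by rewrite leq_mul2r leqnSn orbT.
  apply: leq_trans h2; rewrite mulnA mulnC leq_mul2l; apply/orP; right; lia.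
apply: leq_trans (leq_mul (leqnn Q) h3) _; lia.
Qed.

(** Non-expanding pairs and pairs with too many fixed points each make up at most a quarter, so half
    of all pairs remain for the greedy choice. *)
Lemma exists_far_good_family (R : realType) (ws : seq (seq ('I_2 * bool))) M k :
  all (fun w => reduced w && (w != [::])) ws ->
  exists n, [/\ k <= n, 0 < n & exists v : nat -> {ffun 'I_2 -> 'S_n},
    [/\ forall s, s <= k -> v s \notin non_expander n 88,
        forall s w, s <= k -> w \in ws ->
          M * #|[set x | word_perm (v s) w x == x]| < n &
        forall s t, s < t -> t <= k -> v t \notin near_conjugates (n %/ 4) (v s)]].
Proof.
move=> /(card_words_many_fix M 4)[n1 H1].
(* The summands serve the word count, the growth of n, the expander count and the factorial estimate
   with C = 4(k+1). *)
pose n := n1 + k + 800 + 32 * (4 * k.+1) + 4.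
exists n; split; rewrite /n ?addn4 //; first lia.
rewrite -addn4 -/n.
have h1 : n1 <= n by lia.
have h2 : 800 <= n by lia.
have h3 : 32 * (4 * k.+1) + 4 <= n by lia.
have {H1}w4 := H1 _ h1; have e4 := @card_non_expander_le R _ h2; have f4 := ffact_sqr_le_fact h3.
set Wd := [set u | _] in w4.
pose G := ~: (non_expander n 88 :|: Wd).
have fp : 0 < n`! ^ 2 by rewrite expn_gt0 fact_gt0.
have cG : n`! ^ 2 <= 2 * #|G|.
  have := cardsC (non_expander n 88 :|: Wd); rewrite -/G card_ffun_perm.
  have : #|non_expander n 88 :|: Wd| <= #|non_expander n 88| + #|Wd| by exact: leq_card_setU.
  lia.
have dn : n %/ 4 <= n by lia.
have kG : k * (n`! * (n ^_ (n %/ 4)) ^ 2) < #|G|.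
  have : 4 * k.+1 * (n`! * (n ^_ (n %/ 4)) ^ 2) <= n`! ^ 2.
    by rewrite mulnCA -mulnn leq_mul.
  lia.
have [v [vG vN]] := greedy_family (fun u => card_near_conjugates u dn) kG.
exists v; split=> // [s /vG|s w /vG].
  by rewrite !inE negb_or => /andP[].
rewrite !inE negb_or => /andP[_ /hasPn h] /h; by rewrite -ltnNge.
Qed.

(** * The representations *)

Local Open Scope complex_scope.
Local Open Scope classical_set_scope.
Local Open Scope ring_scope.

(** Freeness gives a member avoiding any given integer, so finitely many integers can be discarded
    one at a time. *)
Lemma freeUltrafilter_tail (omega : freeUltrafilter) (K : nat) :
  \forall k \near ufilter omega, (K <= k)%N.
Proof.
elim: K => [|K IH]; first exact: nearW.
have : \forall k \near ufilter omega, k <> K.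
  have : ~ (\bigcap_(A in ufilter omega) A) K by rewrite ufilter_free.
  move/existsNP => [A /not_implyP[oA nAK]].
  by apply: filterS oA => k kA kK; apply: nAK; rewrite -kK.
apply: filterS2 IH => k Kk kK; lia.
Qed.

(** * Representations from sequences of pairs *)

Section Representation.
Context (R : realType) (omega : freeUltrafilter) (n : nat -> nat).
Implicit Types v : forall k, {ffun 'I_2 -> 'S_(n k)}.

Lemma word_perm_push m (u : {ffun 'I_2 -> 'S_m}) a s :
  word_perm u (push a s) = (letter_perm u a * word_perm u s)%g.
Proof.
case: s => [|b s] //=; case: eqP => [->|] //=.
by rewrite letter_perm_inv mulKVg.
Qed.

Lemma word_perm_mul m (u : {ffun 'I_2 -> 'S_m}) s t :
  word_perm u (word_mul s t) = (word_perm u s * word_perm u t)%g.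
Proof.
by elim: s => [|a s IH] /=; rewrite ?mul1g // word_perm_push IH mulgA.
Qed.

Definition word_seq v (x : F2) : prodP n := fun k => word_perm (v k) x.

Definition word_rep v (x : F2) : ultraP R omega n := uclass R omega (word_seq v x).

Lemma word_rep_morph v : {morph word_rep v : x y / (x * y)%g}.
Proof.
move=> x y; rewrite /word_rep -uclassM; congr uclass.
by apply: functional_extensionality_dep => k; exact: word_perm_mul.
Qed.

HB.instance Definition _ v := isMultiplicative.Build _ _ (word_rep v) (@word_rep_morph v).

Lemma word_rep_gen v g :
  word_rep v (fg_gen g) = uclass R omega (fun k => v k g).
Proof.
congr uclass; apply: functional_extensionality_dep => k.
by rewrite /word_seq /= mulg1.
Qed.

(** A quantitative form of vanishing trace: the proportion of fixed points is below 1/k. *)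
Definition asymptotically_free v := forall w, reduced w -> w != [::] ->
  \forall k \near ufilter omega, (k * #|[set x | word_perm (v k) w x == x]%SET| < n k)%N.

Lemma word_rep_sofic v : asymptotically_free v -> sofic_representation (word_rep v).
Proof.
move=> vP g g1; pose p := word_seq v g.
pose f k : R := (n k)%:R^-1 * #|[set i | p k i == i]%SET|%:R.
have w0 : fword g != [::] by apply/eqP => gE; apply: g1; apply: val_inj.
have f0 : f k @[k --> ufilter omega] --> 0.
  apply/cvgrPdist_lt => e e0.
  have tail := freeUltrafilter_tail omega (Num.truncn e^-1).+1.
  apply: filterS2 (vP _ (fword_reduced g) w0) tail => k kn ek.
  have f_ge0 : 0 <= f k by rewrite mulr_ge0 ?invr_ge0.
  rewrite sub0r normrN ger0_norm // /f.
  have n0 : 0 < (n k)%:R :> R by rewrite ltr0n; lia.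
  rewrite ltr_pdivrMl //.
  have k0 : 0 < k%:R :> R by rewrite ltr0n; lia.
  have ek' : e^-1 < k%:R.
    by apply: lt_le_trans (truncnS_gt _) _; rewrite ler_nat.
  rewrite -(ltr_pM2l k0); apply: (@lt_trans _ _ (n k)%:R).
    by rewrite -natrM ltr_nat.
  rewrite mulrCA ltr_pMr // -(ltr_pM2r (_ : 0 < e^-1)) ?invr_gt0 //.
  by rewrite mul1r mulfK ?gt_eqF.
have /cvg_real_complex cf := f0.
(* The trace is evaluated on the explicit representative [p] instead of the chosen one. *)
apply: (@cvg_unique _ (@norm_hausdorff _ _) _ _ _ _ (@cvg_utr R omega n p)).
by apply: cvg_trans cf; apply: near_eq_cvg; apply: nearW => k; rewrite ntr_perm.
Qed.

(** A conjugating class lifts to permutations [r k] that bring both generators within normalised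
    distance 1/4 along the ultrafilter; one common [k] contradicts the separation. *)
Lemma not_conjugated_word_rep v v' : (forall k, (0 < n k)%N) ->
  (\forall k \near ufilter omega, v' k \notin near_conjugates (n k %/ 4) (v k)) ->
  ~ conjugated (word_rep v) (word_rep v').
Proof.
move=> n0 far [q qP]; pose r := urepr q.
have near g : \forall k \near ufilter omega,
    (perm_dist (r k * v k g * (r k)^-1)%g (v' k g) <= n k %/ 4)%N.
  have : uequiv R omega (r * (fun k => v k g) * r^-1)%g (fun k => v' k g).
    have := qP (fg_gen g); rewrite /= !word_rep_gen => e.
    apply/asboolP/uclassP; rewrite -e.
    by rewrite -[q]uclassK !uclassM; congr (_ * _ * _)%g; rewrite [RHS]u_invE.
  move/uequivP/cvgrPdist_lt => /(_ 4^-1); rewrite invr_gt0 ltr0n => /(_ isT).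
  apply: filterS => k; rewrite sub0r normrN ger0_norm ?dH_ge0 // dH_perm.
  rewrite ltr_pdivrMl ?ltr0n // ltr_pdivlMr // -natrM ltr_nat => /ltnW.
  by rewrite leq_divRL.
have := filter_ex (filterI far (filterI (near ord0) (near ord_max))).
move=> [k [/negP kfar [k0 k1]]]; apply: kfar; rewrite inE.
apply/existsP; exists (r k); apply/forallP => g.
by have [->|->] : g = ord0 \/ g = ord_max by case: g => [[|[|//]] ?]; [left|right]; exact/val_inj.
Qed.

End Representation.

(** * From sets to diagonal projections *)

Section Expander.
Context (R : realType) (m : nat).

Lemma diag_projectionE (e : 'M[R[i]]_m) i j : diag_projection e ->
  e i j = ((i == j) && (e i i != 0))%:R.
Proof.
move=> [/is_diag_mxP ed ee _]; have [<-|ij] := eqVneq i j; last exact: ed.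
have := congr1 (fun M : 'M[R[i]]_m => M i i) ee.
rewrite !mxE (bigD1 i) //= big1 ?addr0 => [|k ki]; last by rewrite ed ?mul0r // eq_sym.
have [->|e0] := eqVneq (e i i) 0; first by [].
by rewrite -[RHS]mulr1 => /(mulfI e0) ->.
Qed.

(** Conjugation puts the entry of [e] at p i in position i, so row i changes whenever i lies in the
    support of [e] and p i does not. *)
Lemma dH_conj_ge (e : 'M[R[i]]_m) (p : 'S_m) : diag_projection e ->
  m%:R^-1 * #|p @: [set i | e i i != 0]%SET :\: [set i | e i i != 0]%SET|%:R <=
    dH e (perm_mx p *m e *m (perm_mx p) ^t* %sesqui).
Proof.
move=> eP; rewrite /dH ler_wpM2l ?invr_ge0 // ler_nat.
rewrite -(card_imset _ (@perm_inj _ p^-1%g)); apply: subset_leq_card.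
apply/fintype.subsetP => _ /imsetP[_ /finset.setDP[/imsetP[i iA ->] piA] ->].
rewrite permK inE; apply/existsP; exists i.
rewrite tr_perm_mx map_perm_mx -row_permE -col_permE !mxE.
by move: iA piA; rewrite !inE => iA /negbNE /eqP ->.
Qed.

Lemma lambda_expander_word (u : {ffun 'I_2 -> 'S_m}) : u \notin non_expander m 88 ->
  lambda_expander (88^-1 : R) u.
Proof.
move=> uP e eP /andP[e_gt0 e_le].
set A := [set i | e i i != 0]%SET.
have trE : ntr e = (m%:R^-1 * #|A|%:R)%:C.
  rewrite rmorphM /= fmorphV !rmorph_nat /ntr; congr (_ * _).
  rewrite /mxtrace -sum1_card natr_sum [RHS]big_mkcond.
  by apply: eq_bigr => i _; rewrite (diag_projectionE _ _ eP) eqxx inE; case: (_ != _).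
have m0 : (0 < m)%N.
  rewrite lt0n; apply/negP => /eqP m0; move: e_gt0.
  by rewrite trE (_ : m%:R = 0 :> R) ?m0 // invr0 mul0r ltxx.
have mR : 0 < m%:R :> R by rewrite ltr0n.
have A0 : (0 < #|A|)%N.
  by rewrite lt0n; apply: contraTneq e_gt0 => A0; rewrite trE A0 mulr0 ltxx.
have A2 : (2 * #|A| <= m)%N.
  move: e_le; rewrite trE -(rmorph_nat (@real_complex R)) -fmorphV lecR.
  by rewrite ler_pdivrMl // ler_pdivlMr // -natrM ler_nat mulnC.
move: uP; rewrite inE => /existsPn/(_ A); rewrite A0 A2 /= => /forallPn[g].
rewrite -ltnNge => gA.
rewrite trE -rmorphM ltcR; apply: (@lt_le_trans _ _ (m%:R^-1 * #|u g @: A :\: A|%:R)).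
  rewrite mulrCA ltr_pM2l ?invr_gt0 // ltr_pdivrMl // -natrM ltr_nat //.
apply: le_trans (dH_conj_ge (u g) eP) _.
by rewrite (bigD1 g) //= lerDl sumr_ge0 // => i _; exact: dH_ge0.
Qed.

End Expander.


Lemma conjugated_sym (R : realType) (omega : freeUltrafilter) (n : nat -> nat) (G : groupType)
    (Theta Psi : {multiplicative G -> ultraP R omega n}) :
  conjugated Theta Psi -> conjugated Psi Theta.
Proof.
by move=> [q qP]; exists q^-1%g => g; rewrite -qP invgK !mulgA mulVg mul1g mulgKV.
Qed.

(** Shortness refers to the [pickle] code, not the length: the lists are finite and every nonempty
    reduced word eventually enters them. *)
Definition short_words k : seq (seq ('I_2 * bool)) :=
  [seq w <- pmap unpickle (iota 0 k) | reduced w && (w != [::])].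

Lemma mem_short_words k w :
  reduced w -> w != [::] -> (pickle w < k)%N -> w \in short_words k.
Proof.
move=> rw w0 wk; rewrite mem_filter rw w0 /= mem_pmap; apply/mapP.
by exists (pickle w); rewrite ?mem_iota ?pickleK.
Qed.

Theorem theorem5p12 (R : realType) (omega : freeUltrafilter) :
  exists (n : nat -> nat) (Theta : R -> {multiplicative F2 -> ultraP R omega n}),
    [/\ forall k, (0 < n k)%N,
        n k @[k --> \oo] --> \oo,
        forall i : R, i \in `[0, 1] -> sofic_representation (Theta i),
        forall i : R, i \in `[0, 1] -> expander_representation (Theta i) &
        forall i j : R, i \in `[0, 1] -> j \in `[0, 1] -> i <> j ->
          ~ conjugated (Theta i) (Theta j)].
Proof.
(* At level [k] the multiplier [M] is [k] too, as [asymptotically_free] requires. The pairs are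
   extracted afterwards because their type depends on [n k]. *)
have [n nP] := choice (fun k =>
  exists_far_good_family R k k (filter_all _ _ : all _ (short_words k))).
have VE k := cid (let: And3 _ _ h := nP k in h).
pose V k := projT1 (VE k).
have VP k : [/\ forall s, (s <= k)%N -> V k s \notin non_expander (n k) 88,
    forall s w, (s <= k)%N -> w \in short_words k ->
      (k * #|[set x | word_perm (V k s) w x == x]%SET| < n k)%N &
    forall s t, (s < t)%N -> (t <= k)%N ->
      V k t \notin near_conjugates (n k %/ 4) (V k s)] := projT2 (VE k).
pose c (i : R) k := Num.truncn (i * k%:R).
have cle i k : i \in `[0, 1] -> (c i k <= k)%N.
  rewrite in_itv /= => /andP[i0 i1]; rewrite /c truncn_le_nat.
  by apply: (@le_lt_trans _ _ k%:R); rewrite ?ltr_nat // ler_piMl.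
have n0 k : (0 < n k)%N by have [] := nP k.
exists n, (fun i => word_rep R omega (fun k => V k (c i k))); split=> //.
- apply/cvgnyPge => A; exists A => // k /= Ak.
  by apply: leq_trans Ak _; have [] := nP k.
- move=> i i01; apply: word_rep_sofic => w rw w0.
  apply: filterS (freeUltrafilter_tail omega (pickle w).+1) => k wk.
  by have [_ H _] := VP k; apply: H; rewrite ?cle ?mem_short_words.
- move=> i i01; exists 88^-1; split; first by rewrite invr_gt0.
  exists 2%N, (@fg_gen _), (fun g k => V k (c i k) g); split=> [g|k].
    exact: word_rep_gen.
  by apply: lambda_expander_word; have [H _ _] := VP k; apply: H; exact: cle.
(* The greedy choice separates later pairs from earlier ones only, so the indices are ordered
   first. *)
suff H i j : i \in `[0, 1] -> j \in `[0, 1] -> i < j ->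
    ~ conjugated (word_rep R omega (fun k => V k (c i k)))
                 (word_rep R omega (fun k => V k (c j k))).
  move=> i j i01 j01 /eqP; rewrite neq_lt => /orP[ij|ji]; first exact: H.
  by move/conjugated_sym; exact: H.
move=> i01 j01 ij; apply: not_conjugated_word_rep => //.
apply: filterS (freeUltrafilter_tail omega (Num.truncn (j - i)^-1).+1) => k kij.
have [_ _] := VP k; apply; last exact: cle.
(* Then j k >= i k + 1, which makes the floor of j k strictly larger than that of i k. *)
have kij' : 1 <= (j - i) * k%:R.
  rewrite -ler_pdivrMl ?subr_gt0 // mulr1 ltW //.
  by apply: lt_le_trans (truncnS_gt _) _; rewrite ler_nat.
have i0 : 0 <= i by move: i01; rewrite in_itv => /andP[].
rewrite truncn_gt_nat -natr1.
have /andP[ci _] := truncn_itv (mulr_ge0 i0 (ler0n R k)).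
by rewrite -/(c i k) in ci; lra.
Qed.
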